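(* Let $\lambda$ be a nonzero real number. For integers $n\ge 0$ let $(x)_{0,\lambda}=1$ and $(x)_{n,\lambda}=x(x-\lambda)\cdots(x-(n-1)\lambda)$ for $n\ge1$. Define the degenerate Eulerian polynomials $A_{n,\lambda}(x)$ by $\sum_{j=0}^{\infty}(j+1)_{n,\lambda}x^{j}=\frac{A_{n,\lambda}(x)}{(1-x)^{n+1}}$ for $|x|<1$, and the degenerate Eulerian numbers $A_\lambda(n,k)$ by $A_{n,\lambda}(x)=\sum_{k=0}^{n}A_{\lambda}(n,k)x^{k}$. Then for all integers $n,k\ge0$, \[\sum_{i=0}^{k}\binom{n+1}{i}(-1)^{i}(k-i+1)_{n,\lambda}=\begin{cases}A_{\lambda}(n,k), & 0\le k\le n,\\ 0, & k>n.\end{cases}\]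
   Context: $A_{n,\lambda}(x)$ is a polynomial of degree at most $n$ in $x$. *)

(* Defs.v *)
From HB Require Import structures.
From mathcomp Require Import all_boot all_order all_algebra.
From mathcomp Require Import all_classical all_reals all_analysis.

Set Implicit Arguments.
Unset Strict Implicit.
Unset Printing Implicit Defensive.

Import Order.TTheory GRing.Theory Num.Theory numFieldNormedType.Exports.
Local Open Scope classical_set_scope.
Local Open Scope ring_scope.

Definition degenerate_falling (R : realType) (lambda : R) (n : nat) (x : R) : R :=
  \prod_(i < n) (x - i%:R * lambda).

Definition is_degenerate_eulerian_poly (R : realType) (lambda : R) (n : nat)
    (A : {poly R}) : Prop :=
  (size A <= n.+1)%N /\
  forall x : R, `|x| < 1 ->
    series (fun j : nat => degenerate_falling lambda n (j%:R + 1) * x ^+ j) @ \oo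
      --> A.[x] / (1 - x) ^+ n.+1.

(* The polynomial A_{n,lambda} selected by its generating function; a polynomial
   is determined by its values on |x| < 1, so at most one satisfies the
   predicate. The value 0 would be returned only if there were none. *)
Definition degenerate_eulerian_poly (R : realType) (lambda : R) (n : nat) :
    {poly R} :=
  xget 0 [set A : {poly R} | is_degenerate_eulerian_poly lambda n A].

Definition degenerate_eulerian_number (R : realType) (lambda : R) (n k : nat) : R :=
  (degenerate_eulerian_poly lambda n)`_k.

(* Main.v *)
(* Multiplying the generating function of a sequence by 1 - x takes its backward
   difference, so multiplying by (1 - x)^(n+1) takes the (n+1)-st iterated
   difference, whose k-th term is the alternating binomial sum. For
   f(j) = (j+1)_{n,lambda}, a polynomial of degree n in j, this iterated difference
   vanishes for k > n, so A_{n,lambda} is the polynomial with these coefficients.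
   Passing to the limit needs f(j) x^j -> 0 for |x| < 1, obtained from the
   closure of subexponential sequences under sums and products. *)

Require Import Defs.
From HB Require Import structures.
From mathcomp Require Import all_boot all_order all_algebra.
From mathcomp Require Import all_classical all_reals all_analysis.
From mathcomp Require Import ring lra.

Set Implicit Arguments.
Unset Strict Implicit.
Unset Printing Implicit Defensive.

Import Order.TTheory GRing.Theory Num.Theory numFieldNormedType.Exports.
Local Open Scope classical_set_scope.
Local Open Scope ring_scope.

(* The sequence is extended by 0 to negative indices, hence the value at 0. *)
Definition bdiff (R : zmodType) (f : nat -> R) (k : nat) : R :=
  if k is k'.+1 then f k - f k' else f 0%N.

(** Induction on [m] through Pascal's rule; the sum stops at [k] because terms of negative index are
    zero. *)
Lemma iter_bdiffE (R : comPzRingType) (f : nat -> R) (m k : nat) :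
  iter m (@bdiff R) f k
  = \sum_(i < k.+1) 'C(m, i)%:R * (-1) ^+ i * f (k - i)%N.
Proof.
elim: m k => [|m IH] k.
  rewrite big_ord_recl big1 => [|i _]; first by rewrite bin0 expr0 !mul1r addr0 subn0.
  by rewrite bin_small // mul0r mul0r.
case: k => [|k] /=; first by rewrite IH !big_ord1 !bin0.
rewrite !IH big_ord_recl [RHS]big_ord_recl !bin0 -addrA; congr (_ + _).
rewrite -sumrB; apply: eq_bigr => i _.
by rewrite lift0 subSS binS natrD exprS; ring.
Qed.

(** Substituting ['X - 1] keeps the degree and the leading coefficient, so the top terms cancel. *)
Lemma size_sub_comp_Xsub1 (R : idomainType) (p : {poly R}) (m : nat) :
  (size p <= m.+1)%N -> (size (p - (p \Po ('X - 1%:P)))%R <= m)%N.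
Proof.
have sX : size ('X - 1%:P : {poly R}) = 2%N by rewrite size_XsubC.
rewrite leq_eqVlt => /orP[/eqP sp|]; last first.
  by rewrite ltnS => sp; rewrite (leq_trans (size_polyD _ _)) // geq_max sp
    size_polyN size_comp_poly2.
have leadE : (p \Po ('X - 1%:P))`_m = p`_m.
  have := lead_coef_comp p (q := 'X - 1%:P); rewrite sX => /(_ isT).
  by rewrite lead_coefXsubC expr1n mulr1 /lead_coef size_comp_poly2 // sp.
apply/leq_sizeP => j; rewrite leq_eqVlt coefB => /orP[/eqP <-|mj].
  by rewrite leadE subrr.
by rewrite !nth_default ?subrr ?size_comp_poly2 ?sp.
Qed.

(** Each difference lowers the degree but also looks one index back, so the threshold [a] from which
    the sequence is polynomial rises by one each time. *)
Lemma iter_bdiff_poly_eq0 (R : idomainType) (m a : nat) (p : {poly R})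
    (f : nat -> R) :
  (size p <= m)%N -> (forall k, (a <= k)%N -> f k = p.[k%:R]) ->
  forall k, (a + m <= k)%N -> iter m (@bdiff R) f k = 0.
Proof.
elim: m a p f => [|m IH] a p f sp fp k ak.
  rewrite /= fp; last by rewrite -(addn0 a).
  by move: sp; rewrite leqn0 size_poly_eq0 => /eqP ->; rewrite horner0.
rewrite iterSr (IH a.+1 _ _ (size_sub_comp_Xsub1 sp)) //; last by rewrite addSnnS.
case=> // j aj; rewrite /bdiff !fp // ?(ltnW aj) //.
by rewrite !hornerE horner_comp !hornerE -natr1 addrK.
Qed.

Section Subexponential.
Variable R : realType.
Implicit Types f g : nat -> R.

(** Equivalently, the power series with coefficients [f] has radius of convergence at least 1. *)
Definition subexponential f :=
  forall y : R, 0 <= y < 1 -> exists M, forall j, `|f j| * y ^+ j <= M.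

Lemma subexponential_cst (c : R) : subexponential (fun=> c).
Proof.
move=> y /andP[y0 y1]; exists `|c| => j.
by rewrite ler_piMr // exprn_ile1 // ltW.
Qed.

Lemma subexponential_nat : subexponential (fun j => j%:R).
Proof.
move=> y /andP[y0 y1]; exists (1 - y)^-1 => j.
rewrite -[leRHS]mul1r ler_pdivlMr ?subr_gt0 // normr_nat.
(* This amounts to [j y^j <= 1 + y + ... + y^(j-1)], a form that goes through induction. *)
suff : j%:R * y ^+ j * (1 - y) <= 1 - y ^+ j.
  by move=> /le_trans; apply; rewrite gerBl exprn_ge0.
elim: j => [|j IH]; first by rewrite mul0r mul0r expr0 subrr.
have yj0 : 0 <= y ^+ j by rewrite exprn_ge0.
have yj1 : y ^+ j <= 1 by rewrite exprn_ile1 // ltW.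
have yIH := ler_wpM2l y0 IH.
(* This product is exactly the slack left once the induction hypothesis is multiplied by [y]. *)
have yu : 0 <= (1 - y) * (1 - y * y ^+ j).
  by rewrite mulr_ge0 ?subr_ge0 ?mulr_ile1 // ltW.
rewrite -natr1 exprS; lra.
Qed.

Lemma subexponentialD f g : subexponential f -> subexponential g ->
  subexponential (fun j => f j + g j).
Proof.
move=> hf hg y hy; have [M HM] := hf y hy; have [N HN] := hg y hy.
exists (M + N) => j; apply: le_trans (lerD (HM j) (HN j)).
rewrite -mulrDl ler_wpM2r ?ler_normD // exprn_ge0 //.
by case/andP: hy.
Qed.

Lemma sqrt_in01 (y : R) : 0 <= y < 1 -> 0 <= Num.sqrt y < 1.
Proof.
move=> /andP[y0 y1]; rewrite sqrtr_ge0 /= -sqrtr1 ltr_sqrt //; lra.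
Qed.

(* Splitting y as sqrt y * sqrt y gives each factor its own geometric decay. *)
Lemma subexponentialM f g : subexponential f -> subexponential g ->
  subexponential (fun j => f j * g j).
Proof.
move=> hf hg y hy; have hs := sqrt_in01 hy.
have [M HM] := hf _ hs; have [N HN] := hg _ hs.
exists (M * N) => j; have /andP[y0 _] := hy.
rewrite -[in X in X ^+ j](sqr_sqrtr y0) exprAC expr2 normrM mulrACA.
by apply: ler_pM; rewrite ?HM ?HN // mulr_ge0 // exprn_ge0 // sqrtr_ge0.
Qed.

Lemma subexponential_bdiff f : subexponential f -> subexponential (bdiff f).
Proof.
move=> hf y hy; have [M HM] := hf y hy; have /andP[y0 /ltW y1] := hy.
have M0 : 0 <= M by apply: le_trans (HM 0%N); rewrite mulr_ge0 ?exprn_ge0.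
exists (M + M) => -[|j] /=; first by rewrite (le_trans (HM 0%N)) // lerDl.
apply: le_trans (_ : (`|f j.+1| + `|f j|) * y ^+ j.+1 <= _).
  by rewrite ler_wpM2r ?exprn_ge0 ?ler_normB.
rewrite mulrDl lerD ?HM //; apply: le_trans (HM j).
by rewrite ler_wpM2l // exprSr ler_piMr ?exprn_ge0.
Qed.

(** One factor [sqrt |x|] per index keeps [f] bounded; the other drives the product to 0. *)
Lemma subexponential_cvg0 f (x : R) : subexponential f -> `|x| < 1 ->
  (fun j => f j * x ^+ j) @ \oo --> (0 : R).
Proof.
move=> hf x1; have hx : 0 <= `|x| < 1 by rewrite normr_ge0.
have [M HM] := hf _ (sqrt_in01 hx); have /andP[s0 s1] := sqrt_in01 hx.
apply/norm_cvg0P.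
apply: (@squeeze_cvgr _ _ _ _ (fun=> 0) (fun j => M * Num.sqrt `|x| ^+ j)).
- near=> j; rewrite normr_ge0 /= normrM normrX.
  rewrite -[in X in X ^+ j](sqr_sqrtr (normr_ge0 x)) exprAC expr2 mulrA.
  by rewrite ler_wpM2r ?HM // exprn_ge0.
- exact: cvg_cst.
- rewrite -[X in _ --> X](mulr0 M); apply: cvgMl_tmp.
  by apply: cvg_expr; rewrite ger0_norm.
Unshelve. all: by end_near. Qed.

(** Summation by parts: multiplication by [1 - x] at the level of partial sums, with its boundary
    term. *)
Lemma series_bdiff f (x : R) (N : nat) :
  series (fun j => bdiff f j * x ^+ j) N.+1
  = (1 - x) * series (fun j => f j * x ^+ j) N.+1 + x * (f N * x ^+ N).
Proof.
elim: N => [|N IH]; rewrite /series /=.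
  by rewrite !big_nat1 expr0 /=; ring.
rewrite big_nat_recr // [in RHS]big_nat_recr //=.
move: IH; rewrite /series /= => ->; rewrite exprS; ring.
Qed.

Lemma cvg_series_bdiff f (x l : R) : subexponential f -> `|x| < 1 ->
  series (fun j => bdiff f j * x ^+ j) @ \oo --> l ->
  series (fun j => f j * x ^+ j) @ \oo --> l / (1 - x).
Proof.
move=> hf x1 hl; have x1n : 1 - x != 0.
  by apply: contraTneq x1 => /subr0_eq <-; rewrite normr1 ltxx.
rewrite -cvg_shiftS.
(* Solving for the partial sums of [f] yields their convergence together with the limit. *)
have -> : (fun N => series (fun j => f j * x ^+ j) N.+1) =
  (fun N => (series (fun j => bdiff f j * x ^+ j) N.+1 - x * (f N * x ^+ N))
             / (1 - x)).
  by apply/funext => N; rewrite series_bdiff addrK mulrC mulKf.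
apply: cvgMr_tmp; rewrite -[X in _ --> X]subr0 -[X in _ --> _ - X](mulr0 x).
apply: cvgB; first by rewrite (cvg_shiftS (series (fun j => bdiff f j * x ^+ j))).
by apply: cvgMl_tmp; apply: subexponential_cvg0.
Qed.

Lemma cvg_series_iter_bdiff (m : nat) f (x l : R) :
  subexponential f -> `|x| < 1 ->
  series (fun j => iter m (@bdiff R) f j * x ^+ j) @ \oo --> l ->
  series (fun j => f j * x ^+ j) @ \oo --> l / (1 - x) ^+ m.
Proof.
move=> + x1; elim: m f => [|m IH] f hf; first by rewrite expr0 divr1.
rewrite iterSr => /(IH _ (subexponential_bdiff hf)).
move=> /(cvg_series_bdiff hf x1).
by rewrite -mulrA -invfM -exprSr.
Qed.

End Subexponential.

Lemma cvg_series_finite_support (R : realType) (m : nat) (c : nat -> R) (x : R) :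
  (forall k, (m <= k)%N -> c k = 0) ->
  series (fun j => c j * x ^+ j) @ \oo --> (\poly_(k < m) c k).[x].
Proof.
move=> c0; apply: cvg_near_cst; near=> N.
have mN : (m <= N)%N by near: N; exact: nbhs_infty_ge.
rewrite horner_poly /series /= (big_cat_nat (leq0n m) mN) //= big_mkord.
rewrite [X in _ + X]big_nat_cond [X in _ + X]big1 ?addr0 // => j.
by rewrite andbT => /andP[mj _]; rewrite c0 // mul0r.
Unshelve. all: by end_near. Qed.

Lemma poly_eq_on_unit_disc (R : realType) (p q : {poly R}) :
  (forall x, `|x| < 1 -> p.[x] = q.[x]) -> p = q.
Proof.
move=> pq; apply/eqP; rewrite -subr_eq0; apply/eqP.
(* The points 1/2, 1/3, ... of the disc are distinct roots of [p - q], too many for its size. *)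
pose s := [seq (i.+2%:R : R)^-1 | i <- iota 0 (size (p - q)%R)].
apply: (@roots_geq_poly_eq0 _ _ s); last by rewrite size_map size_iota.
- apply/allP => _ /mapP[i _ ->]; rewrite /root !hornerE subr_eq0 pq //.
  by rewrite ger0_norm // invf_lt1 ?ltr0n // ltr1n.
- rewrite map_inj_uniq ?iota_uniq // => i j /invr_inj /eqP.
  by rewrite eqr_nat => /eqP [].
Qed.

Section DegenerateFalling.
Variables (R : realType) (lambda : R) (n : nat).

Let values (j : nat) : R := degenerate_falling lambda n (j%:R + 1).

Lemma subexponential_degenerate_falling : subexponential values.
Proof.
rewrite /values; elim: n => [|m IH].
  rewrite /degenerate_falling; under eq_fun do rewrite big_ord0.
  exact: subexponential_cst.
rewrite /degenerate_falling; under eq_fun do rewrite big_ord_recr /= -addrA.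
apply: subexponentialM => //; apply: subexponentialD.
  exact: subexponential_nat.
exact: subexponential_cst.
Qed.

Lemma iter_bdiff_degenerate_falling k : (n < k)%N ->
  iter n.+1 (@bdiff R) values k = 0.
Proof.
(* As a polynomial in [x], this is [(x+1)_{n,lambda}], of size [n.+1]. *)
pose p : {poly R} := \prod_(i < n) ('X - (i%:R * lambda - 1)%:P).
move=> nk; apply: (@iter_bdiff_poly_eq0 _ n.+1 0 p) => //.
  by rewrite /p size_prod_XsubC -[index_enum _]enumT size_enum_ord.
move=> j _; rewrite /p horner_prod; apply: eq_bigr => i _.
by rewrite hornerXsubC; ring.
Qed.

Lemma degenerate_eulerian_polyE :
  degenerate_eulerian_poly lambda n
  = \poly_(k < n.+1) iter n.+1 (@bdiff R) values k.
Proof.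
(* Membership of the candidate and uniqueness are shown in turn, so the default 0 of [xget] is never
   what selects the value. *)
apply: xget_subset1.
  split=> [|x x1]; first exact: size_poly.
  apply: cvg_series_iter_bdiff => //.
    exact: subexponential_degenerate_falling.
  apply: cvg_series_finite_support => k; exact: iter_bdiff_degenerate_falling.
move=> A B [_ hA] [_ hB]; apply: poly_eq_on_unit_disc => x x1.
have x1n : (1 - x) ^+ n.+1 != 0.
  by rewrite expf_neq0 //; apply: contraTneq x1 => /subr0_eq <-; rewrite normr1 ltxx.
apply: (mulIf (invr_neq0 x1n)).
by apply: cvg_unique (hA x x1) (hB x x1).
Qed.

End DegenerateFalling.

Theorem theorem2p2 (R : realType) (lambda : R) (hlambda : lambda != 0) (n k : nat) :
  \sum_(i < k.+1) 'C(n.+1, i)%:R * (-1) ^+ i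
      * degenerate_falling lambda n (k%:R - i%:R + 1)
  = if (k <= n)%N then degenerate_eulerian_number lambda n k else 0.
Proof.
transitivity (iter n.+1 (@bdiff R)
    (fun j => degenerate_falling lambda n (j%:R + 1)) k).
  (* Since [i <= k], the truncated difference [k - i] agrees with the real one. *)
  by rewrite iter_bdiffE; apply: eq_bigr => i _; rewrite natrB // -ltnS.
case: leqP => [kn|]; last exact: iter_bdiff_degenerate_falling.
by rewrite /degenerate_eulerian_number degenerate_eulerian_polyE coef_poly ltnS kn.
Qed.
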